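(* For any $\ell>0$, $\Delta>0$ and $T>1$, there exist an $\ell$-smooth function $f:\mathbb{R}\to\mathbb{R}$ and $x_0$ with $f(x_0)-\inf_x f(x)\le\Delta$ such that, if we run AMSGrad-norm with deterministic gradients, $0<v_0\le\frac{\ell\gamma}{2}$, and $\gamma_t=\frac{\gamma}{(t+1)^{\alpha}}$ with $\gamma\le\frac{4\Delta}{v_0}$, we have: (1) if $0<\alpha<1$, then for any $0\le\beta_1<1$ and $0\le\beta_2\le1$, $$\min_{t\in\{0,1,\dots,T-1\}}|\nabla f(x_t)|\ge\sqrt{\frac{\Delta}{16\max\left\{1/\ell,\ \frac{\gamma}{(1-\alpha)v_0}T^{1-\alpha}\right\}}};$$ (2) if $\alpha=0$, then for $\beta_1=0$ and any $0\le\beta_2\le1$, $$\min_{t\in\{0,1,\dots,T-1\}}|\nabla f(x_t)|\ge v_0.$$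
   Context: A function $f$ is $\ell$-smooth if it is differentiable and $\|\nabla f(x)-\nabla f(y)\|\le\ell\|x-y\|$ for all $x,y$. AMSGrad-norm: given an initial point $x_0$, momentum parameters $0\le\beta_1<1$ and $0\le\beta_2\le1$, a stepsize sequence $\{\gamma_t\}$, initial momentum $m_0$ and $v_0>0$, set $\hat v_0=v_0$ and for $t=0,1,2,\dots$ $$m_{t+1}=\beta_1m_t+(1-\beta_1)g(x_t;\xi_t),\qquad v_{t+1}^2=\beta_2v_t^2+(1-\beta_2)\|g(x_t;\xi_t)\|^2,$$ $$\hat v_{t+1}^2=\max\{\hat v_t^2,v_{t+1}^2\},\qquad x_{t+1}=x_t-\frac{\gamma_t}{\sqrt{\hat v_{t+1}^2}}\,m_{t+1}.$$ Here $g(x_t;\xi_t)$ is the stochastic gradient at $x_t$; deterministic gradients means $g(x_t;\xi_t)=\nabla f(x_t)$.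
   Formalization: The function f and the point x_0 may depend on γ, v_0, α and m_0 (but not on β_1, β_2), i.e. these are fixed before f is chosen; with f chosen from ℓ, Δ, T alone, as the wording literally says, the claim is false. *)

(* Defs.v *)
From mathcomp Require Import all_boot all_order all_algebra.
From mathcomp Require Import all_classical all_reals all_analysis.
Set Implicit Arguments.
Unset Strict Implicit.
Unset Printing Implicit Defensive.
Import Order.TTheory GRing.Theory Num.Theory.
Import numFieldNormedType.Exports.
Local Open Scope ring_scope.

(* On the real line the gradient of [f] is [derive1 f]; its postfix notation is
   hidden here by that of the derivative of polynomials. *)

Definition smooth (R : realType) (l : R) (f : R -> R) : Prop :=
  (forall x, derivable f x 1) /\
  (forall x y, `|derive1 f x - derive1 f y| <= l * `|x - y|).

(* The infimum is taken in the extended reals: the real-valued [inf] of a set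
   that is not bounded below is 0, whereas here the gap of a function that is
   not bounded below is +oo. *)
Definition gap (R : realType) (f : R -> R) (x : R) : \bar R :=
  ((f x)%:E - ereal_inf (range (EFin \o f)))%E.

(* [vsq] and [vhatsq] hold the squares v_t^2 and \hat v_t^2, the only form in
   which these quantities enter the recursion. *)
Record amsgrad_state (R : realType) := AMSGradState {
  point : R;
  momentum : R;
  vsq : R;
  vhatsq : R
}.

(* [g t x] stands for the stochastic gradient g(x; xi_t). *)
Definition amsgrad_step (R : realType) (g : nat -> R -> R) (step : nat -> R)
    (beta1 beta2 : R) (t : nat) (s : amsgrad_state R) : amsgrad_state R :=
  let gt := g t (point s) in
  let m := beta1 * momentum s + (1 - beta1) * gt in
  let v2 := beta2 * vsq s + (1 - beta2) * `|gt| ^+ 2 in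
  let vh2 := Num.max (vhatsq s) v2 in
  AMSGradState (point s - step t / Num.sqrt vh2 * m) m v2 vh2.

Fixpoint amsgrad_norm (R : realType) (g : nat -> R -> R) (step : nat -> R)
    (beta1 beta2 x0 m0 v0 : R) (t : nat) : amsgrad_state R :=
  match t with
  | 0%N => AMSGradState x0 m0 (v0 ^+ 2) (v0 ^+ 2)
  | t'.+1 => amsgrad_step g step beta1 beta2 t'
               (amsgrad_norm g step beta1 beta2 x0 m0 v0 t')
  end.

Definition poly_step (R : realType) (gamma alpha : R) (t : nat) : R :=
  gamma / t.+1%:R `^ alpha.

Definition amsgrad_det (R : realType) (f : R -> R)
    (gamma alpha beta1 beta2 x0 m0 v0 : R) (t : nat) : R :=
  point (amsgrad_norm (fun=> derive1 f) (poly_step gamma alpha)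
           beta1 beta2 x0 m0 v0 t).

(* For T > 0 the seed (the value at t = 0) of the iterated minimum belongs to
   the family, so this is exactly the minimum over t in {0, ..., T - 1}. *)
Definition min_grad (R : realType) (f : R -> R) (x : nat -> R) (T : nat) : R :=
  \big[Num.min/`|derive1 f (x 0%N)|]_(t < T) `|derive1 f (x t)|.

(* Main.v *)
(* The functions are chosen so that all gradients of the run have the same
   absolute value.

   For alpha = 0, momentum-free steps on the parabola (v0 / gamma) x^2 started
   at gamma / 2 oscillate: the gradients have absolute value v0, so the
   normalizer stays v0 and every step maps x to - x.

   For 0 < alpha < 1, take a function of slope e in absolute value on a
   half-line, flattened to a constant beyond it at rate l.  It is oriented so
   that the initial momentum m0 pushes uphill; then the downhill component of
   the momentum, an average of m0 and of gradients, never exceeds e.  As the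
   normalizer is at least v0, after T steps the point is at most
   e / v0 * \sum_t gamma_t <= e C away from x0 downhill, where
   C = gamma T^(1-alpha) / ((1 - alpha) v0), so putting the bend at distance
   e C keeps all gradients equal to e, at the price of the gap
   e^2 C + e^2 / (2 l), which is at most Delta for the claimed value of e. *)
Require Import Defs.
From mathcomp Require Import all_boot all_order all_algebra.
From mathcomp Require Import all_classical all_reals all_analysis.
From mathcomp Require Import ring lra.
Set Implicit Arguments.
Unset Strict Implicit.
Unset Printing Implicit Defensive.
Import Order.TTheory GRing.Theory Num.Theory.
Import numFieldNormedType.Exports.
Local Open Scope ring_scope.

(** * Derivatives from quadratic error bounds; the sum of the stepsizes *)

Lemma is_derive_quadratic_error (R : realType) (f : R -> R) (x a K : R) :
  (forall y, `|f y - f x - a * (y - x)| <= K * (y - x) ^+ 2) ->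
  is_derive x 1 f a.
Proof.
move=> fP.
have K_ge0 : 0 <= K.
  by have := le_trans (normr_ge0 _) (fP (x + 1)); rewrite addrAC subrr; lra.
(* The difference quotient at [h] is within [K * |h|] of [a]; dividing by [K + 1] below covers
   [K = 0]. *)
have fcvg : (h^-1 *: ((f \o shift x) (h *: 1) - f x) @[h --> 0^'] --> a)%classic.
  apply/cvgrPdist_le => /= e e_gt0; near=> h.
  have h_neq0 : h != 0 by near: h; exact: nbhs_dnbhs_neq.
  have h_gt0 : 0 < `|h| by rewrite normr_gt0.
  have h_le : `|h| <= e / (K + 1).
    by near: h; apply: dnbhs0_le; rewrite divr_gt0// ltr_wpDl.
  have := fP (h + x); rewrite addrK => err.
  rewrite /= /shift /= [h *: 1]mulr1 -(ler_pM2l h_gt0) -normrM.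
  rewrite -normrN.
  have -> : - (h * (a - h^-1 *: (f (h + x) - f x))) = f (h + x) - f x - a * h.
    by rewrite /GRing.scale /=; field.
  apply: le_trans err _; rewrite -normr_id -real_normK ?num_real// normr_id.
  rewrite expr2 mulrA [leRHS]mulrC ler_pM2r//.
  apply: le_trans (_ : (K + 1) * `|h| <= e); first by nra.
  by rewrite mulrC -ler_pdivlMr// ltr_wpDl.
by split; [apply/cvg_ex; exists a | exact: cvg_lim fcvg].
Unshelve. all: by end_near. Qed.

Lemma derive1_quadratic_error (R : realType) (f f' : R -> R) (K : R) :
  (forall x y, `|f y - f x - f' x * (y - x)| <= K * (y - x) ^+ 2) ->
  derive1 f = f'.
Proof.
move=> fP; apply/funext => x; rewrite derive1E.
by have := is_derive_quadratic_error (fP x) => /@derive_val.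
Qed.

Lemma smooth_quadratic_error (R : realType) (f f' : R -> R) (K l : R) :
  (forall x y, `|f y - f x - f' x * (y - x)| <= K * (y - x) ^+ 2) ->
  (forall x y, `|f' x - f' y| <= l * `|x - y|) ->
  smooth l f.
Proof.
move=> fP f'P; split=> [x|x y]; last by rewrite (derive1_quadratic_error fP).
by have := is_derive_quadratic_error (fP x) => /@ex_derive.
Qed.

Lemma normr_sqr1 (R : realType) (s : R) : s ^+ 2 = 1 -> `|s| = 1.
Proof. by move=> s2; rewrite -sqrtr_sqr s2 sqrtr1. Qed.

Lemma gap_nneg (R : realType) (f : R -> R) (x : R) :
  (forall y, 0 <= f y) -> (gap f x <= (f x)%:E)%E.
Proof.
move=> f_ge0; rewrite /gap -[leRHS]sube0; apply: leeB => //.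
by apply: le_ereal_inf_tmp => _ [y _ <-]; rewrite lee_fin.
Qed.

Lemma min_grad_ge (R : realType) (f : R -> R) (x : nat -> R) (T : nat) (e : R) :
  (0 < T)%N -> (forall t, (t < T)%N -> e <= `|derive1 f (x t)|) ->
  e <= min_grad f x T.
Proof. by move=> T_gt0 eP; apply: le_bigmin => [|i _]; apply: eP. Qed.

(** By induction: after multiplication by [(1 - alpha) (n+1)^alpha], the increment reduces to
    n^(1-alpha) (n+1)^alpha <= n + alpha, a weighted AM-GM inequality, obtained from Young with
    exponents 1/(1-alpha) and 1/alpha. *)
Lemma sum_powRN_le (R : realType) (alpha : R) (n : nat) : 0 < alpha < 1 ->
  \sum_(k < n) (k.+1%:R `^ alpha)^-1 <= n%:R `^ (1 - alpha) / (1 - alpha) :> R.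
Proof.
move=> /andP[a0 a1]; have b0 : 0 < 1 - alpha by rewrite subr_gt0.
elim: n => [|n IHn].
  by rewrite big_ord0 divr_ge0 ?powR_ge0 ?ltW.
rewrite big_ord_recr /=; apply: le_trans (lerD IHn (lexx _)) _.
have q0 : 0 < n.+1%:R `^ alpha :> R by rewrite powR_gt0.
have young : n%:R `^ (1 - alpha) * n.+1%:R `^ alpha <=
    n%:R * (1 - alpha) + n.+1%:R * alpha :> R.
  have := @conjugate_powR R (n%:R `^ (1 - alpha)) (n.+1%:R `^ alpha)
    (1 - alpha)^-1 alpha^-1 (powR_ge0 _ _) (powR_ge0 _ _).
  rewrite -!powRrM !divff ?gt_eqF// !powRr1 ?ler0n// !invrK; apply.
  - by rewrite invr_gt0.
  - by rewrite invr_gt0.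
  - by rewrite subrK.
rewrite [n.+1%:R `^ (_ - _)]powRD ?pnatr_eq0 ?implybT// powRr1 ?ler0n// powRN.
rewrite -(ler_pM2r b0) mulrDl !mulfVK ?gt_eqF//.
rewrite -(ler_pM2r q0) mulrDl mulfVK ?gt_eqF//.
rewrite mulrAC mulVf ?gt_eqF// mul1r; apply: le_trans (lerD young (lexx _)) _.
by rewrite -natr1; lra.
Qed.

(** * The parabola, for alpha = 0 *)

Section Parabola.
Variables (R : realType) (a : R).

Let err (x y : R) : `|a * y ^+ 2 - a * x ^+ 2 - 2 * a * x * (y - x)| <=
  `|a| * (y - x) ^+ 2.
Proof.
have -> : a * y ^+ 2 - a * x ^+ 2 - 2 * a * x * (y - x) = a * (y - x) ^+ 2.
  by ring.
by rewrite normrM [`|_ ^+ 2|]ger0_norm// sqr_ge0.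
Qed.

Lemma derive1_parabola : derive1 (fun x : R => a * x ^+ 2) = (fun x => 2 * a * x).
Proof. exact: derive1_quadratic_error err. Qed.

Lemma smooth_parabola (l : R) : 0 <= a -> 2 * a <= l ->
  smooth l (fun x : R => a * x ^+ 2).
Proof.
move=> a0 al; apply: (smooth_quadratic_error err) => x y.
rewrite -mulrBr normrM ger0_norm ?mulr_ge0//.
by rewrite ler_wpM2r.
Qed.

End Parabola.

Lemma amsgrad_det_parabola (R : realType) (gamma m0 v0 beta2 : R) (t : nat) :
  0 < gamma -> 0 < v0 ->
  `|amsgrad_det (fun x => v0 / gamma * x ^+ 2) gamma 0 0 beta2 (gamma / 2)
      m0 v0 t| = gamma / 2.
Proof.
move=> g0 v00; rewrite /amsgrad_det.
set s := amsgrad_norm _ _ _ _ _ _ _.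
suff [] : [/\ `|Defs.point (s t)| = gamma / 2, vsq (s t) = v0 ^+ 2 &
              vhatsq (s t) = v0 ^+ 2] by [].
elim: t => [|t [IHx IHv IHh]]; first by split=> //=; rewrite ger0_norm// ltW// divr_gt0.
rewrite /s /= -/s IHv IHh derive1_parabola.
have -> : `|2 * (v0 / gamma) * Defs.point (s t)| = v0.
  rewrite normrM IHx ger0_norm; first by field; rewrite gt_eqF.
  by rewrite mulr_ge0// ltW// divr_gt0.
have -> : beta2 * v0 ^+ 2 + (1 - beta2) * v0 ^+ 2 = v0 ^+ 2 by ring.
rewrite maxxx sqrtr_sqr (ger0_norm (ltW v00)) /poly_step powRr0 invr1 mulr1.
(* The update subtracts [gamma / v0] times [2 * (v0 / gamma) * x], that is 2x. *)
split=> //; rewrite -[RHS]IHx -normrN; congr Num.norm.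
by field; rewrite !gt_eqF.
Qed.

(** * The flattened linear function, for 0 < alpha < 1 *)

Section Ramp.
Variable R : realType.

(** A convex primitive of the positive part. *)
Definition half_sq (u : R) : R := Num.max 0 u ^+ 2 / 2.

Lemma half_sq_error (x y : R) :
  0 <= half_sq y - half_sq x - Num.max 0 x * (y - x) <= (y - x) ^+ 2 / 2.
Proof. by have := sqr_ge0 (y - x); rewrite /half_sq; case: (lerP 0 x) => ?; case: (lerP 0 y) => ? ?; apply/andP; split; nra. Qed.

Variables (l c b s : R).

(* Slope [- s * l * c] where [s * x <= b - c], constant where [s * x >= b]. *)
Definition ramp (x : R) : R := l * (half_sq (b - s * x) - half_sq (b - s * x - c)).

Let slope (x : R) : R :=
  - s * (l * (Num.max 0 (b - s * x) - Num.max 0 (b - s * x - c))).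

Hypotheses (l0 : 0 <= l) (c0 : 0 <= c) (s2 : s ^+ 2 = 1).

Lemma ramp_ge0 (x : R) : 0 <= ramp x.
Proof.
apply: mulr_ge0 => //; rewrite subr_ge0 /half_sq ler_pM2r ?invr_gt0//.
have max_ge0 (v : R) : 0 <= Num.max 0 v by rewrite le_max lexx.
rewrite ler_sqr ?nnegrE//.
by rewrite ge_max !le_max lexx /= gerBl c0 orbT.
Qed.

Let err (x y : R) : `|ramp y - ramp x - slope x * (y - x)| <= l * (y - x) ^+ 2.
Proof.
pose err_at (d : R) := half_sq (b - s * y - d) - half_sq (b - s * x - d)
  - Num.max 0 (b - s * x - d) * (- s * (y - x)).
have errP d : 0 <= err_at d <= (y - x) ^+ 2 / 2.
  have := half_sq_error (b - s * x - d) (b - s * y - d).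
  have -> : b - s * y - d - (b - s * x - d) = - s * (y - x) by ring.
  by rewrite exprMn sqrrN s2 mul1r.
have -> : ramp y - ramp x - slope x * (y - x) = l * (err_at 0 - err_at c).
  by rewrite /ramp /slope /err_at !subr0; ring.
(* Both errors lie in [0, (y-x)^2/2] by convexity, hence so does the absolute value of their
   difference. *)
have /andP[? ?] := errP 0; have /andP[? ?] := errP c.
rewrite normrM ger0_norm// ler_wpM2l// ler_norml; apply/andP; split; lra.
Qed.

Lemma smooth_ramp : smooth l ramp.
Proof.
apply: (smooth_quadratic_error err) => x y.
have s1 := normr_sqr1 s2.
rewrite /slope -mulrBr -mulrBr !normrM normrN s1 mul1r ger0_norm// ler_wpM2l//.
have -> : `|x - y| = `|(b - s * x) - (b - s * y)|.
  have -> : b - s * x - (b - s * y) = - s * (x - y) by ring.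
  by rewrite normrM normrN s1 mul1r.
(* As [c] is nonnegative, max(0,u) - max(0,u-c) is [u] clamped to [0,c], which is 1-Lipschitz in
   [u]. *)
move: (b - s * x) (b - s * y) => u v.
rewrite ler_norml; case: (lerP v u) => [vu|/ltW uv];
  rewrite ?(ger0_norm (_ : 0 <= u - v)) ?(ler0_norm (_ : u - v <= 0)) ?subr_ge0 ?subr_le0//;
  case: (lerP 0 u) => ?; case: (lerP 0 v) => ?; case: (lerP 0 (u - c)) => ?;
  case: (lerP 0 (v - c)) => ?; apply/andP; split; lra.
Qed.

Lemma derive1_ramp (x : R) : s * x <= b - c -> derive1 ramp x = - s * (l * c).
Proof.
move=> xb; rewrite (derive1_quadratic_error err) /slope.
rewrite !max_r; first by congr (_ * (_ * _)); ring.
- by lra.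
- by move: c0; lra.
Qed.

End Ramp.

(** * Drift of the iterates under a constant slope *)

Section ConstantSlope.
Variables (R : realType) (g : nat -> R -> R) (step : nat -> R).
Variables (beta1 beta2 x0 m0 v0 e D s : R) (T : nat).
Hypotheses (v0_gt0 : 0 < v0) (b1 : 0 <= beta1 < 1) (e0 : 0 <= e).
Hypotheses (s2 : s ^+ 2 = 1) (sm0 : - e <= s * m0).
Hypothesis step0 : forall t, 0 <= step t.
Hypothesis gE : forall t x, s * x <= D -> g t x = - s * e.
Hypothesis drift : s * x0 + e / v0 * \sum_(k < T) step k <= D.

Let st := amsgrad_norm g step beta1 beta2 x0 m0 v0.

Lemma amsgrad_constant_slope (t : nat) : (t <= T)%N -> s * Defs.point (st t) <= D.
Proof.
have drift_le n : (n <= T)%N -> s * x0 + e / v0 * \sum_(k < n) step k <= D.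
  move=> nT; apply: le_trans drift.
  rewrite lerD2l ler_wpM2l ?divr_ge0 ?(ltW v0_gt0)//.
  by rewrite -(subnKC nT) big_split_ord /= lerDl sumr_ge0.
move=> tT; apply: le_trans (drift_le t tT).
(* Gradients are known only where [s * x <= D], so the three bounds are carried together: the
   position bound at [t] gives access to [gE] for the next step. *)
suff [] : [/\ s * Defs.point (st t) <= s * x0 + e / v0 * \sum_(k < t) step k,
    - e <= s * momentum (st t) & v0 ^+ 2 <= vhatsq (st t)] by [].
elim: t tT => [|t IHt] tT; first by rewrite big_ord0 mulr0 addr0.
have [IHx IHm IHv] := IHt (ltnW tT).
have xD := le_trans IHx (drift_le t (ltnW tT)).
rewrite /st /= -/st (gE _ xD) big_ord_recr /=.
set m := beta1 * _ + _; set vh := Num.max _ _.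
have vh_ge : v0 ^+ 2 <= vh by rewrite le_max IHv.
have m_ge : - e <= s * m.
  have -> : s * m = beta1 * (s * momentum (st t)) - (1 - beta1) * (s ^+ 2 * e).
    by rewrite /m; ring.
  by rewrite s2; case/andP: b1 => *; nra.
split=> //; clearbody m vh.
have r_ge : v0 <= Num.sqrt vh.
  by rewrite -(ger0_norm (ltW v0_gt0)) -sqrtr_sqr ler_wsqrtr.
have r_gt0 := lt_le_trans v0_gt0 r_ge.
rewrite mulrBr mulrDr addrA lerD//.
have -> : - (s * (step t / Num.sqrt vh * m)) = step t / Num.sqrt vh * - (s * m).
  by ring.
apply: le_trans (_ : step t / Num.sqrt vh * e <= _).
  by rewrite ler_wpM2l ?divr_ge0 ?(ltW r_gt0)// lerNl.
rewrite [leRHS]mulrC [e / _]mulrC mulrA ler_wpM2r// ler_wpM2l//.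
by rewrite lef_pV2.
Qed.

End ConstantSlope.

Theorem theorem8 (R : realType) (l Delta : R) (T : nat)
    (l_gt0 : 0 < l) (Delta_gt0 : 0 < Delta) (T_gt1 : (1 < T)%N)
    (gamma v0 alpha m0 : R)
    (v0_gt0 : 0 < v0) (v0_le : v0 <= l * gamma / 2)
    (gamma_le : gamma <= 4 * Delta / v0) :
  exists (f : R -> R) (x0 : R),
    [/\ smooth l f,
        (gap f x0 <= Delta%:E)%E,
        0 < alpha < 1 ->
          forall beta1 beta2 : R, 0 <= beta1 < 1 -> 0 <= beta2 <= 1 ->
          min_grad f (amsgrad_det f gamma alpha beta1 beta2 x0 m0 v0) T >=
          Num.sqrt (Delta / (16 * Num.max (1 / l)
            (gamma / ((1 - alpha) * v0) * T%:R `^ (1 - alpha))))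
      & alpha = 0 ->
          forall beta2 : R, 0 <= beta2 <= 1 ->
          min_grad f (amsgrad_det f gamma alpha 0 beta2 x0 m0 v0) T >= v0].
Proof.
have gamma_gt0 : 0 < gamma.
  by rewrite -(pmulr_rgt0 _ l_gt0); lra.
have T_gt0 : (0 < T)%N by exact: ltnW.
(* [alpha] is fixed before [f], so the function may depend on the case; the claim for the other case
   is then vacuous. *)
case: (boolP (0 < alpha < 1)) => [/[dup] alpha01 /andP[alpha_gt0 alpha_lt1]|alphaN].
  set C := gamma / _ * _; set M := Num.max _ _.
  have M_gt0 : 0 < M by rewrite lt_max divr_gt0.
  have [lM CM] : 1 / l <= M /\ C <= M by rewrite !le_max !lexx orbT.
  set e := Num.sqrt _.
  have e2 : e ^+ 2 * (16 * M) = Delta.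
    by rewrite sqr_sqrtr ?mulfVK ?divr_ge0 ?mulr_ge0 ?ltW// gt_eqF// mulr_gt0.
  have e_ge0 : 0 <= e by rewrite sqrtr_ge0.
  have C_ge0 : 0 <= C.
    by rewrite mulr_ge0 ?powR_ge0// divr_ge0 ?ltW// mulr_gt0// subr_gt0.
  have eC_ge0 : 0 <= e * C by exact: mulr_ge0.
  have [s s2 sm0] : exists2 s : R, s ^+ 2 = 1 & 0 <= s * m0.
    by case: (lerP 0 m0) => m00; [exists 1 | exists (-1)];
      rewrite ?sqrrN ?expr1n ?mul1r// mulN1r oppr_ge0 ltW.
  have c_ge0 : 0 <= e / l by rewrite divr_ge0// ltW.
  have l_ge0 := ltW l_gt0.
  have s1 := normr_sqr1 s2.
  (* At rate [l], the slope [e] vanishes over a length [e / l]; the bend starts at distance [e * C]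
     from 0. *)
  exists (ramp l (e / l) (e * C + e / l) s), 0; split.
  - exact: smooth_ramp.
  - apply: le_trans (gap_nneg _ _) _; first exact: ramp_ge0.
    rewrite lee_fin /ramp mulr0 subr0 addrK /half_sq !max_r ?addr_ge0//.
    have -> : l * ((e * C + e / l) ^+ 2 / 2 - (e * C) ^+ 2 / 2)
        = e ^+ 2 * (C + 1 / l / 2) by field; rewrite gt_eqF.
    (* Here C + 1/(2l) <= 3M/2 <= 16M. *)
    by rewrite -e2 ler_wpM2l ?sqr_ge0//; lra.
  - move=> _ beta1 beta2 b1 _; apply: min_grad_ge => // t tT.
    have gradE : l * (e / l) = e by rewrite mulrC mulfVK// gt_eqF.
    suff xD : s * amsgrad_det (ramp l (e / l) (e * C + e / l) s)
        gamma alpha beta1 beta2 0 m0 v0 t <= e * C.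
      by rewrite (derive1_ramp l_ge0 c_ge0 s2) ?addrK//
        gradE normrM normrN s1 mul1r ler_norm.
    apply: (@amsgrad_constant_slope _ _ _ _ _ _ _ _ e _ _ T) => //.
    + by apply: le_trans sm0; rewrite oppr_le0.
    + by move=> k; rewrite divr_ge0 ?powR_ge0// ltW.
    + by move=> _ x xD; rewrite (derive1_ramp l_ge0 c_ge0 s2) ?addrK// gradE.
    + rewrite mulr0 add0r /poly_step -mulr_sumr -mulrA ler_wpM2l//.
      apply: le_trans (ler_wpM2l _ (ler_wpM2l (ltW gamma_gt0) (sum_powRN_le T alpha01))) _.
        by rewrite invr_ge0 ltW.
      by rewrite /C le_eqVlt; apply/orP; left; apply/eqP; field; rewrite !gt_eqF// subr_gt0.
    + exact: ltnW.
  - by move=> a0; move: alpha_gt0; rewrite a0 ltxx.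
exists (fun x => v0 / gamma * x ^+ 2), (gamma / 2); split=> //.
(* The curvature [2 * v0 / gamma] is at most [l] by [v0_le]; below, the gap [gamma * v0 / 4] is at
   most [Delta] by [gamma_le]. *)
- apply: smooth_parabola; first by rewrite divr_ge0 ?ltW.
  by rewrite mulrA ler_pdivrMr//; lra.
- apply: le_trans (gap_nneg _ _) _ => [y|].
    by rewrite mulr_ge0 ?sqr_ge0// divr_ge0 ?ltW.
  move: gamma_le; rewrite lee_fin ler_pdivlMr// => gv.
  have -> : v0 / gamma * (gamma / 2) ^+ 2 = gamma * v0 / 4.
    by field; rewrite gt_eqF.
  by lra.
- move=> -> beta2 _; apply: min_grad_ge => // t _.
  rewrite derive1_parabola normrM amsgrad_det_parabola// ger0_norm.
    by rewrite le_eqVlt; apply/orP; left; apply/eqP; field; rewrite gt_eqF.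
  by rewrite mulr_ge0// divr_ge0 ?ltW.
Qed.
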